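(* Let $w \ge 1$ and $a \ge 0$ be integers, let $n = 2w+a$, and suppose that there exists a nontrivial $1$-perfect code $C$ in $J(n,w)$. Write $\Phi_1(w,a) = 1+w(w+a) = p_1 p_2 \cdots p_r$ as a product of primes, and for $1 \le i \le r$ let $\alpha_i = \lfloor \log_{p_i}(w+a) \rfloor + 1$. Then $$\left|\sum_{i=1}^r \frac{1}{\alpha_i} - (1 + \log_{w+a} w) \right| < \frac{4}{\sqrt{w+a}}.$$
   Context: For integers $0 \le w \le n$, the Johnson graph $J(n,w)$ has as vertex set $V^n_w$, the set of all $w$-element subsets of $\{1,2,\ldots,n\}$; two vertices are adjacent if their intersection has size $w-1$. The distance between two $w$-sets is half the size of their symmetric difference. The $1$-sphere of a vertex is the set of all $w$-sets within distance at most $1$ of it; for $n=2w+a$ it has cardinality $\Phi_1(w,a)=1+w(w+a)$. A code $C \subseteq V^n_w$ is called $1$-perfect if the $1$-spheres of the codewords of $C$ form a partition of $V^n_w$. A $1$-perfect code is called trivial if it consists of a single codeword, or if $n=2w$ and it consists of a pair of disjoint $w$-subsets; otherwise it is nontrivial. *)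

(* Defs.v *)
From mathcomp Require Import all_boot all_order all_algebra.
From mathcomp Require Import reals exp.
Set Implicit Arguments.
Unset Strict Implicit.
Unset Printing Implicit Defensive.
Import Order.TTheory GRing.Theory Num.Theory.

Section JohnsonGraph.
Variable n : nat.
Implicit Types (A B : {set 'I_n}) (C : {set {set 'I_n}}).

(* The vertex set of J(n, w), with ground set {0, ..., n - 1} instead of
   {1, ..., n}. *)
Definition johnson_vertices (w : nat) : {set {set 'I_n}} :=
  [set A : {set 'I_n} | #|A| == w].

(* The halving is exact, as it is only used on sets of equal cardinality. *)
Definition johnson_dist A B : nat := #|(A :\: B) :|: (B :\: A)|./2.

Definition johnson_sphere1 (w : nat) A : {set {set 'I_n}} :=
  [set B in johnson_vertices w | (johnson_dist A B <= 1)%N].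

(* The spheres are taken as a family indexed by the codewords: distinct
   codewords must have disjoint spheres, which [finset.partition] applied to
   the image set of C would not require of two codewords with equal spheres. *)
Definition perfect1 (w : nat) C : Prop :=
  [/\ C \subset johnson_vertices w,
      {in C &, forall A B, A != B ->
         [disjoint johnson_sphere1 w A & johnson_sphere1 w B]} &
      \bigcup_(A in C) johnson_sphere1 w A = johnson_vertices w].

Definition trivial_code (w : nat) C : Prop :=
  (exists A, C = [set A])
  \/ n = (2 * w)%N /\
     exists A B, [/\ A \in johnson_vertices w, B \in johnson_vertices w,
                     [disjoint A & B] & C = [set A; B]].

End JohnsonGraph.

(* The cardinality of a 1-sphere in J(2w + a, w). *)
Definition Phi1 (w a : nat) : nat := (1 + w * (w + a))%N.

Local Open Scope ring_scope.

Definition logb (R : realType) (b x : R) : R := ln x / ln b.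

Definition alpha (R : realType) (p m : nat) : int :=
  Num.floor (logb (p%:R : R) m%:R) + 1.

(* Main.v *)
Require Import Defs.
From mathcomp Require Import all_boot all_order all_algebra.
From mathcomp Require Import reals sequences exp.
From mathcomp Require Import zify ring lra.
Import Order.TTheory GRing.Theory Num.Theory.

Set Implicit Arguments.
Unset Strict Implicit.
Unset Printing Implicit Defensive.

(** Write m = w + a, Phi = 1 + w * m, L = ln m.  Every prime p dividing Phi has
    a power p ^ alpha lying just above m; so ln p is close to L / alpha, and
    summing over the prime factors, the sum of the 1 / alpha is close to
    ln Phi / L, which is close to ln (w * m) / L = 1 + log_m w.

    Why p ^ alpha is close to m.  A perfect code is a design of large strength.
    Counting the w-sets that contain a j-set S, each through the unique codeword
    of its sphere, gives a linear equation between the number g(S) of codewords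
    above S and the numbers g(S - s) ([design_recursion]).  The coefficient of
    g(S) is the eigenvalue Phi - j (n + 1 - j) of the sphere operator.  As long
    as it has not vanished, induction on j determines g(S): Phi g(S) is the
    binomial C(n - j, w - j) ([perfect_design]).  It must vanish for some
    j <= w, as Phi would otherwise divide C(n - w, 0) = 1.  With the first such
    j written as w - x, the vanishing says w = x (x + a) + x + 1, and Phi divides
    C(n - i, w - i) for every i < w - x ([nontrivial_parameters]).  By Pascal's
    rule, Phi divides C(l + l', l) whenever l <= w and l' <= m fall short of w
    and m by less than w - x in total.

    By Kummer's criterion, for a prime p dividing Phi each of these additions
    l + l' must have a carry in base p.  If p ^ alpha were larger than m + x + 1,
    one could choose l and l' that add without carry ([prime_power_close]).
    So m < p ^ alpha <= m + x + 1, where x is about the square root of w at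
    most; the rest is estimation ([inv_sum_estimate]). *)

(** * Spheres and sets above a given set *)

Lemma card_setD_sym (T : finType) (A B : {set T}) :
  #|A| = #|B| -> #|A :\: B| = #|B :\: A|.
Proof. by rewrite -(cardsID B A) -(cardsID A B) setIC => /addnI. Qed.

Lemma mem_johnson_sphere1 n w (A B : {set 'I_n}) : #|A| = w ->
  (B \in johnson_sphere1 w A) = (#|B| == w) && (#|A :\: B| <= 1).
Proof.
move=> wA; rewrite !inE; case: eqP => //= wB; rewrite /johnson_dist.
have eqD : #|B :\: A| = #|A :\: B| by apply: card_setD_sym; rewrite wA.
rewrite cardsU disjoint_setI0 ?cards0 ?eqD ?subn0 ?addnn ?doubleK //.
by rewrite -setI_eq0; apply/eqP/setP => z; rewrite !inE; case: (z \in A); case: (z \in B).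
Qed.

(** The members of the sphere other than its center A arise, each once, by
    exchanging an element y of A for an element z outside A; the pair (y, z) is
    recovered from the two set differences. *)
Lemma sum_johnson_sphere1 n w (A : {set 'I_n}) (F : {set 'I_n} -> nat) : #|A| = w ->
  \sum_(B in johnson_sphere1 w A) F B
    = F A + \sum_(y in A) \sum_(z in ~: A) F (z |: A :\ y).
Proof.
move=> wA.
have inA : A \in johnson_sphere1 w A.
  by rewrite mem_johnson_sphere1 // wA eqxx setDv cards0.
rewrite (big_setD1 A inA) /=; congr (_ + _).
pose f (u : 'I_n * 'I_n) := u.2 |: A :\ u.1.
have fD u : u \in setX A (~: A) -> A :\: f u = [set u.1] /\ f u :\: A = [set u.2].
  case: u => y z; rewrite !inE /= => /andP[yA zA].
  split; apply/setP => t; rewrite !inE.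
    case: (eqVneq t z) => [->|_]; first rewrite (negbTE zA) andbF.
      by apply/esym/eqP => e; rewrite e yA in zA.
    by case: (eqVneq t y) => [->|_]; rewrite ?yA //=; case: (t \in A).
  case: (eqVneq t z) => [->|_] /=; first by rewrite zA.
  by case: (t \in A); rewrite ?andbF.
have -> : johnson_sphere1 w A :\ A = f @: setX A (~: A).
  apply/setP => B; apply/idP/imsetP.
    rewrite in_setD1 mem_johnson_sphere1 // => /andP[BA /andP[/eqP wB dAB]].
    have eqD : #|B :\: A| = #|A :\: B| by apply: card_setD_sym; rewrite wA.
    have dAB1 : #|A :\: B| == 1.
      rewrite eqn_leq dAB lt0n cards_eq0 setD_eq0; apply: contra BA => sAB.
      by rewrite eq_sym eqEcard sAB wA wB leqnn.
    have /cards1P[z Dz] : #|B :\: A| == 1 by rewrite eqD.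
    have /cards1P[y Dy] := dAB1.
    have : y \in A :\: B by rewrite Dy inE.
    have : z \in B :\: A by rewrite Dz inE.
    rewrite !inE => /andP[zA zB] /andP[yB yA].
    exists (y, z); first by rewrite !inE yA.
    apply/setP => t; rewrite !inE /=.
    move/setP/(_ t): Dz; move/setP/(_ t): Dy; rewrite !inE.
    by case: (t \in A); case: (t \in B); case: (t == y); case: (t == z).
  move=> [u uX ->]; have [Dy Dz] := fD u uX.
  have ne : f u != A.
    by apply/eqP => e; move: Dy; rewrite e setDv => /setP/(_ u.1); rewrite !inE eqxx.
  rewrite in_setD1 ne mem_johnson_sphere1 // Dy cards1 andbT /=.
  have := cardsID (f u) A; have := cardsID A (f u).
  by rewrite Dy Dz !cards1 setIC wA => <- [->].
rewrite big_imset /=; last first.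
  move=> u v uX vX e; have [uy uz] := fD u uX; have [vy vz] := fD v vX.
  have : u.1 \in A :\: f v by rewrite -e uy inE.
  have : u.2 \in f v :\: A by rewrite -e uz inE.
  by rewrite vy vz !inE => /eqP e2 /eqP e1; apply: injective_projections.
rewrite pair_big_dep /=; apply: eq_big => [[y z]|[y z] _] //=; by rewrite !inE.
Qed.

Lemma sum_johnson_supsets n w (S : {set 'I_n}) : #|S| <= w ->
  \sum_(B in johnson_vertices n w) (S \subset B : nat) = 'C(n - #|S|, w - #|S|).
Proof.
move=> leSw.
rewrite -big_mkcondr /= sum1dep_card.
have <- : #|~: S| = n - #|S| by have := cardsC S; rewrite card_ord; lia.
rewrite -cards_draws -(@card_in_imset _ _ (fun B => B :\: S)); last first.
  move=> B1 B2; rewrite !inE => /andP[_ s1] /andP[_ s2] /setP e.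
  apply/setP => t; have := e t; have := subsetP s1 t; have := subsetP s2 t.
  rewrite !inE; case: (t \in S) => //= -> // -> //.
congr #|pred_of_set _|; apply/setP => B; rewrite inE; apply/imsetP/andP.
  case=> B'; rewrite !inE => /andP[/eqP wB s] ->; split.
    by apply/subsetP => t; rewrite !inE => /andP[].
  by rewrite cardsD (setIidPr s) wB.
move=> [sB /eqP cB]; have dis : B :&: S = set0.
  by apply/eqP; rewrite setI_eq0 -(setCK S) -subsets_disjoint.
exists (B :|: S).
  by rewrite !inE cardsU dis cards0 cB subn0 subnK // eqxx subsetUr.
by apply/setP => t; move/setP/(_ t): dis; rewrite !inE; case: (t \in B); case: (t \in S).
Qed.

(** * Perfect codes are designs *)

Definition nb_codewords n (C : {set {set 'I_n}}) (S : {set 'I_n}) : nat :=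
  \sum_(A in C) (S \subset A : nat).

(** The right-hand side runs over the codewords and their spheres, which
    partition the w-sets. *)
Lemma perfect_double_count w n (C : {set {set 'I_n}}) (S : {set 'I_n}) :
  perfect1 w C -> #|S| <= w ->
  'C(n - #|S|, w - #|S|)
    = \sum_(A in C) \sum_(B in johnson_sphere1 w A) (S \subset B : nat).
Proof.
move=> [_ disC covC] leSw; rewrite -sum_johnson_supsets //.
rewrite (exchange_big_dep (mem (johnson_vertices n w))) /=; last first.
  by move=> A B _; rewrite inE => /andP[].
apply: eq_bigr => B; rewrite -covC => /bigcupP[A AC BA].
rewrite (bigD1 A) /= ?AC // big1 ?addn0 // => A' /andP[/andP[A'C BA'] neA].
by have := disC _ _ A'C AC neA; rewrite disjoint_subset => /subsetP/(_ _ BA'); rewrite inE BA.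
Qed.

(** An exchange of y for z applied to A gives a superset of S exactly when y is
    outside S and S minus z is inside A.  Two cases contribute: S is inside A
    (any z will do), or z is the only element of S missing from A. *)
Lemma sphere_supsets n w (A S : {set 'I_n}) : #|A| = w -> #|S| <= w -> w <= n ->
  \sum_(B in johnson_sphere1 w A) (S \subset B : nat)
   = (1 + (w - #|S|) * (n - w)) * (S \subset A)
     + (w - #|S|).+1 * \sum_(s in S) ((S :\ s \subset A) && (s \notin A)).
Proof.
move=> wA leSw lewn; rewrite sum_johnson_sphere1 //.
have step y z : y \in A -> z \in ~: A ->
    (S \subset z |: A :\ y) = (y \notin S) && (S :\ z \subset A).
  rewrite inE => yA zA; rewrite -subDset subsetD1 andbC !inE.
  by case: (eqVneq y z) => [e|_] //=; rewrite -e yA in zA.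
have -> : \sum_(y in A) \sum_(z in ~: A) (S \subset z |: A :\ y : nat)
   = #|A :\: S| * \sum_(z in ~: A) (S :\ z \subset A).
  transitivity (\sum_(y in A) (y \notin S) * \sum_(z in ~: A) (S :\ z \subset A)).
    apply: eq_bigr => y yA; rewrite big_distrr /=; apply: eq_bigr => z zA.
    by rewrite step // mulnb.
  rewrite -big_distrl /= -big_mkcondr /= -sum1_card; congr (_ * _).
  by apply: eq_bigl => y; rewrite !inE andbC.
have [sSA|nsSA] := boolP (S \subset A).
  rewrite [X in _ + _ * X = _](eq_bigr (fun=> 1)); last first.
    by move=> z _; rewrite (subset_trans (subsetDl _ _) sSA).
  have cA : #|~: A| = n - w by rewrite cardsCs setCK card_ord wA.
  rewrite sum1_card cA cardsD (setIidPr sSA) wA muln1 [_ * (n - w)]mulnC.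
  rewrite [X in _ = _ + _ * X]big1 ?muln0 ?addn0 // => s sS.
  by rewrite (subsetP sSA) // andbF.
rewrite muln0 !add0n !big_distrr /= [LHS]big_mkcond [RHS]big_mkcond /=.
apply: eq_bigr => z _; rewrite inE.
have [zA|zA] /= := boolP (z \in A); first by rewrite andbF muln0 if_same.
rewrite andbT; have [zS|zS] := boolP (z \in S); last first.
  have -> : S :\ z = S by apply/setDidPl; rewrite disjoint_sym disjoints1.
  by rewrite (negbTE nsSA) muln0.
have [sSA|] := boolP (S :\ z \subset A); last by rewrite !muln0.
rewrite !muln1 cardsD wA.
have -> : A :&: S = S :\ z.
  apply/setP => t; rewrite !inE; case: (eqVneq t z) => [->|tz]; first by rewrite (negbTE zA).
  by have /implyP := subsetP sSA t; rewrite !inE tz /=; case: (t \in S); rewrite ?andbF // andbT.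
by move: leSw; rewrite (cardsD1 z S) zS => leSw; rewrite subnSK.
Qed.

Lemma nb_codewordsD1 n (C : {set {set 'I_n}}) (S : {set 'I_n}) s : s \in S ->
  nb_codewords C (S :\ s)
    = nb_codewords C S + \sum_(A in C) ((S :\ s \subset A) && (s \notin A)).
Proof.
move=> sS; rewrite -big_split /=; apply: eq_bigr => A _.
rewrite -{2}(setD1K sS) subUset sub1set; case: (s \in A); rewrite ?andbF ?andbT ?addn0 //.
Qed.

(** Summing [sphere_supsets] over the codewords.  The codewords that miss only
    the element s of S are those above S minus s that are not above S. *)
Lemma design_recursion w n (C : {set {set 'I_n}}) (S : {set 'I_n}) :
  perfect1 w C -> #|S| <= w -> w <= n ->
  'C(n - #|S|, w - #|S|)
    = (1 + (w - #|S|) * (n - w)) * nb_codewords C S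
      + (w - #|S|).+1 * \sum_(s in S) (nb_codewords C (S :\ s) - nb_codewords C S).
Proof.
move=> pC leSw lewn; rewrite (perfect_double_count pC leSw).
have [/subsetP sC _ _] := pC.
under eq_bigr => A AC.
  rewrite (@sphere_supsets n w) //; last by have := sC A AC; rewrite inE => /eqP.
  over.
rewrite big_split /= -!big_distrr /= exchange_big /=; congr (_ + _ * _).
by apply: eq_bigr => s sS; rewrite nb_codewordsD1 // addKn.
Qed.

(** The arithmetic of the induction step of [perfect_design], at
    w = u + (j + 1) and n = w + v: b is C(n - j - 1, w - j - 1), P + d is
    C(n - j, w - j), and P stands for Phi g(S).  The first hypothesis is the
    absorption identity for binomials, the second one [design_recursion]; they
    imply that b - P is annihilated by the eigenvalue
    Phi - (j + 1) (n - j). *)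
Lemma design_recursion_root (j u v b P d : nat) :
  (u + v + 1) * b = (u + 1) * (P + d) ->
  (1 + (u + j.+1) * v) * b = (1 + u * v) * P + (u + 1) * (j.+1 * d) ->
  P != b -> 1 + (u + j.+1) * v = j.+1 * (u + v + 1).
Proof.
move=> e1 e2 ne; apply/eqP; rewrite -(eqr_nat int) -subr_eq0.
have ne' : (b%:R - P%:R : int)%R != 0%R by rewrite subr_eq0 eqr_nat eq_sym.
apply/eqP/(mulfI ne'); rewrite mulr0.
move: e1 e2 => /(congr1 (fun k => k%:R : int)%R) + /(congr1 (fun k => k%:R : int)%R).
rewrite !(natrD, natrM, mulrS) => e1 e2.
(* the second relation minus (j + 1) times the first, which eliminates d *)
transitivity (((1 + (u%:R + (1 + j%:R)) * v%:R) * b%:R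
    - ((1 + u%:R * v%:R) * P%:R + (u%:R + 1) * ((1 + j%:R) * d%:R)))
  - (1 + j%:R) * ((u%:R + v%:R + 1) * b%:R - (u%:R + 1) * (P%:R + d%:R)) : int)%R.
  by ring.
by rewrite e1 e2 !subrr mulr0 subr0.
Qed.

(** The spheres around all w-sets cover every w-set Phi times, so the counts
    C(n - j, w - j) of all w-sets above S solve Phi times [design_recursion];
    nonzero eigenvalues up to t leave no other solution. *)
Lemma perfect_design w t n (C : {set {set 'I_n}}) :
  perfect1 w C -> w <= n -> t <= w ->
  (forall j, 0 < j <= t -> 1 + w * (n - w) != j * (n.+1 - j)) ->
  forall S : {set 'I_n}, #|S| <= t ->
    (1 + w * (n - w)) * nb_codewords C S = 'C(n - #|S|, w - #|S|).
Proof.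
move=> pC lewn letw root S; move: {-1}#|S| (erefl #|S|) => j.
elim: j S => [|j IH] S cS let_; have := design_recursion pC (S := S) _ lewn; rewrite cS.
  move=> -> //; rewrite big_pred0 ?muln0 ?addn0 ?subn0 // => s.
  by move/eqP: cS; rewrite cards_eq0 => /eqP ->; rewrite inE.
move=> /(_ ltac:(lia)).
set G := nb_codewords C S; set Phi := 1 + w * (n - w).
have IHs s : s \in S -> Phi * nb_codewords C (S :\ s) = 'C(n - j, w - j).
  move=> sS; have cs : #|S :\ s| = j by have := cardsD1 s S; rewrite sS; lia.
  by apply: IH; lia.
have sumE : Phi * \sum_(s in S) (nb_codewords C (S :\ s) - G)
    = j.+1 * ('C(n - j, w - j) - Phi * G).
  rewrite big_distrr /= -cS -sum_nat_const; apply: eq_bigr => s sS.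
  by rewrite mulnBr IHs.
have : Phi * G <= 'C(n - j, w - j).
  have /card_gt0P[s sS] : 0 < #|S| by rewrite cS.
  by rewrite -(IHs s sS) leq_mul2l nb_codewordsD1 // leq_addr orbT.
have := mul_bin_diag (n - j) (w - j.+1).
have -> : (n - j).-1 = n - j.+1 by lia.
have -> : (w - j.+1).+1 = w - j by lia.
have := root j.+1 ltac:(lia); rewrite -/Phi.
move: sumE; set X := \sum_(s in S) _; set b' := 'C(n - j, _); set b := 'C(_, w - j.+1).
move=> eX ne eb le eb2.
have ePb : Phi * b
    = Phi * ((1 + (w - j.+1) * (n - w)) * G) + (w - j) * (j.+1 * (b' - Phi * G)).
  by rewrite eb2 mulnDr; congr (_ + _); rewrite mulnCA -eX.
apply/eqP; move: ne; apply: contraR => neG; apply/eqP.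
case/subnKC: le => le; move: ePb neG; rewrite -{}le in eb *.
rewrite addKn mulnCA -/Phi; move: (b' - Phi * G) eb => d.
move: (Phi * G) => P eb ePb neG.
have [u wE] : exists u, w = u + j.+1 by exists (w - j.+1); lia.
have [v nE] : exists v, n = w + v by exists (n - w); lia.
have -> : n.+1 - j.+1 = u + v + 1 by lia.
have phiE : Phi = 1 + (u + j.+1) * v by rewrite /Phi nE addKn wE.
rewrite phiE; apply: (@design_recursion_root j u v b P d); last exact: neG.
  move: eb; have -> : n - j = u + v + 1 by lia.
  have -> : w - j = u + 1 by lia.
  by [].
rewrite -phiE ePb nE addKn; have -> : w - j.+1 = u by lia.
have -> : w - j = u + 1 by lia.
by [].
Qed.

Lemma exists_card n k : k <= n -> exists S : {set 'I_n}, #|S| = k.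
Proof.
move=> kn; have : 0 < #|[set B : {set 'I_n} | (B \subset setT) && (#|B| == k)]|.
  by rewrite cards_draws cardsT card_ord bin_gt0.
by case/card_gt0P => S; rewrite inE => /andP[_ /eqP]; exists S.
Qed.

(** The first root j of the eigenvalue is w - x.  The case x = 0 would force
    w = 1, where all vertices lie in one sphere and C is a single codeword. *)
Lemma nontrivial_parameters (w a n : nat) (C : {set {set 'I_n}}) :
  0 < w -> n = 2 * w + a -> perfect1 w C -> ~ trivial_code w C ->
  exists x, [/\ 0 < x, w = x * (x + a) + x + 1 &
    forall i, i < w - x -> Phi1 w a %| 'C(n - i, w - i)].
Proof.
move=> w0 nE pC ntC.
have lewn : w <= n by lia.
have nw : n - w = w + a by lia.
pose root j := (0 < j) && (1 + w * (n - w) == j * (n.+1 - j)).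
have cC : Phi1 w a * #|C| = 'C(n, w).
  have := perfect_design (t := 0) pC lewn _ _ (S := set0); rewrite cards0 !subn0 nw => <- //.
    congr (_ * _); rewrite /nb_codewords -sum1_card.
    by apply: eq_bigr => A _; rewrite sub0set.
  by move=> j; lia.
(* without a root, Phi times the number of codewords above a w-set is 1 *)
have ex_root : exists j, root j && (j <= w).
  have [/hasP[j jw rj]|/hasPn nor] := boolP (has root (iota 1 w)).
    by exists j; rewrite rj; move: jw; rewrite mem_iota; lia.
  have [S cS] := exists_card lewn.
  have := perfect_design pC lewn (leqnn w) _ (S := S).
  rewrite cS subnn bin0 nw => H.
  have /eqP : (1 + w * (w + a)) * nb_codewords C S = 1.
    apply: H => // j /andP[j0 jw]; have := nor j; rewrite mem_iota /root j0 nw /=.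
    by apply; lia.
  rewrite muln_eq1; lia.
case: (ex_minnP ex_root) => j /andP[/andP[j0 /eqP rj] jw] jmin.
have [x wE] : exists x, w = j + x by exists (w - j); lia.
have xE : w = x * (x + a) + x + 1.
  move: rj; rewrite nw; have -> : n.+1 - j = j + 2 * x + a + 1 by lia.
  by rewrite wE; nia.
exists x; split => //.
  rewrite lt0n; apply/eqP => x0; apply: ntC; left; apply/cards1P/eqP.
  have w1 : w = 1 by rewrite xE x0; lia.
  move: cC; move: #|C| => c; rewrite /Phi1 w1 bin1; nia.
move=> i ij; have [S cS] : exists S : {set 'I_n}, #|S| = i by apply: exists_card; lia.
apply/dvdnP; exists (nb_codewords C S); rewrite mulnC /Phi1 -nw -cS.
apply/esym/(perfect_design (t := j.-1)) => //; try lia.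
move=> j' /andP[j'0 j'j]; apply/eqP => r'.
by have := jmin j'; rewrite /root j'0 r' eqxx /=; lia.
Qed.

(** * Prime factors of the sphere size *)

(** Half of Kummer's theorem: without carries, Legendre's formula gives the same
    valuation for (l + m)! as for l! m!. *)
Lemma no_carry_bin p l m : prime p ->
  (forall k, 0 < k -> l %% p ^ k + m %% p ^ k < p ^ k) ->
  ~~ (p %| 'C(l + m, l)).
Proof.
move=> pp nc.
have bigE N M : N <= M -> logn p N`! = \sum_(1 <= k < M.+1) N %/ p ^ k.
  move=> leNM; rewrite logn_fact // [RHS](big_cat_nat _ (n := N.+1)) //=.
  rewrite [X in _ = _ + X]big_nat_cond [X in _ = _ + X]big1 ?addn0 //.
  move=> k /andP[/andP[ltNk _] _].
  by rewrite divn_small // (ltn_trans ltNk) // ltn_expl ?prime_gt1.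
have := congr1 (logn p) (bin_fact (leq_addr m l)).
rewrite addKn !lognM ?muln_gt0 ?fact_gt0 ?bin_gt0 ?leq_addr //.
rewrite (bigE _ _ (leqnn (l + m))) (bigE _ _ (leq_addr m l)) (bigE _ _ (leq_addl l m)).
rewrite -big_split /=.
have -> : \sum_(1 <= k < (l + m).+1) (l + m) %/ p ^ k
   = \sum_(1 <= k < (l + m).+1) (l %/ p ^ k + m %/ p ^ k).
  apply: eq_big_nat => k /andP[k0 _].
  by rewrite divnD ?expn_gt0 ?prime_gt0 // leqNgt nc // addn0.
move=> /eqP; rewrite -[X in _ == X]add0n eqn_add2r => /eqP e.
by rewrite -(expn1 p) pfactor_dvdn ?bin_gt0 ?leq_addr // e.
Qed.

(** All base p digits of p ^ k - 1 are maximal, so those of l and m are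
    complementary. *)
Lemma no_carry_pred p k l m : prime p -> l + m = (p ^ k).-1 ->
  ~~ (p %| 'C(l + m, l)).
Proof.
move=> pp e; apply: no_carry_bin => // j j0.
have pj : 0 < p ^ j by rewrite expn_gt0 prime_gt0.
have pk : 0 < p ^ k by rewrite expn_gt0 prime_gt0.
case: (leqP k j) => kj.
  have := leq_pexp2l (prime_gt0 pp) kj.
  have := leq_mod l (p ^ j); have := leq_mod m (p ^ j).
  move: (p ^ j) (p ^ k) pj pk e => P Q; lia.
have dv : p ^ j %| l + m + 1 by rewrite e addn1 prednK // dvdn_exp2l // ltnW.
have : p ^ j %| l %% p ^ j + m %% p ^ j + 1 by rewrite /dvdn -modnDml modnDm modnDml.
have := ltn_pmod l pj; have := ltn_pmod m pj.
move: (p ^ j) (l %% _) (m %% _) => P x y yP xP /dvdnP[[|[|c]]]; [lia|lia|].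
rewrite !mulSn; lia.
Qed.

(** One summand has only zeros below the digit k, so a carry could only come out
    of a digit at or above k, which would bring the sum to p ^ (k + 1). *)
Lemma no_carry_multiple p k l m : prime p ->
  (p ^ k %| l) || (p ^ k %| m) -> l + m < p ^ k.+1 -> ~~ (p %| 'C(l + m, l)).
Proof.
move=> pp dv lt; apply: no_carry_bin => // j j0.
have pj : 0 < p ^ j by rewrite expn_gt0 prime_gt0.
case: (leqP j k) => jk.
  have dj : p ^ j %| p ^ k by rewrite dvdn_exp2l.
  by case/orP: dv => /(dvdn_trans dj) /eqP ->; rewrite ?add0n ?addn0 ltn_pmod.
have := leq_pexp2l (prime_gt0 pp) jk.
have := leq_mod l (p ^ j); have := leq_mod m (p ^ j).
move: (p ^ j) (p ^ k.+1) pj lt => P Q; lia.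
Qed.

Lemma dvd_bin_Pascal d n w t : t <= w -> w <= n ->
  (forall i, i <= t -> d %| 'C(n - i, w - i)) ->
  forall i j, i + j <= t -> d %| 'C(n - i - j, w - i).
Proof.
move=> tw wn H i j; elim: j i => [|j IH] i ijt.
  by rewrite subn0 H //; move: ijt; rewrite addn0.
have d1 : d %| 'C(n - i - j, w - i) by apply: IH; lia.
have d2 : d %| 'C(n - i.+1 - j, w - i.+1) by apply: IH; lia.
move: d1 d2.
have -> : n - i.+1 - j = n - i - j.+1 by lia.
have -> : n - i - j = (n - i - j.+1).+1 by lia.
have -> : w - i = (w - i.+1).+1 by lia.
by rewrite binS => d1 d2; rewrite -(dvdn_addl _ d2).
Qed.

(** With Q = p ^ (k + 1) beyond w + a + x + 1, there are summands l and l', close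
    enough to w and w + a, that add without carry.  If Q - 1 - (w + a) is at
    most w, take it for l: the sum is then Q - 1.  Otherwise 2 w + a is below Q,
    and it suffices to make one summand divisible by p ^ k: round w down to a
    multiple of p ^ k if p ^ k <= w, and else lower w + a to p ^ k.  The
    amounts removed are small enough because w = x (x + a) + x + 1. *)
Lemma prime_power_close w a x p k : 0 < x -> w = x * (x + a) + x + 1 ->
  prime p ->
  (forall i j, i + j < w - x -> p %| 'C(2 * w + a - i - j, w - i)) ->
  p ^ k <= w + a < p ^ k.+1 -> p ^ k.+1 <= w + a + x + 1.
Proof.
move=> x0 wE pp dv /andP[leq_q lt_Q]; rewrite leqNgt; apply/negP => far.
have q0 : 0 < p ^ k by rewrite expn_gt0 prime_gt0.
have Q2 : p ^ k + p ^ k <= p ^ k.+1 by rewrite expnS; have := prime_gt1 pp; nia.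
have bad l m i j : l = w - i -> m = w + a - j -> i + j < w - x -> p %| 'C(l + m, l).
  move=> -> -> ij; have -> : w - i + (w + a - j) = 2 * w + a - i - j by lia.
  exact: dv.
(* a bounds what is removed from w + a, and 2 * x < w serves to bound the
   remainder of w modulo p ^ k *)
have aw : a < w - x by nia.
have xw : 2 * x < w by nia.
case: (leqP (p ^ k.+1 - 1 - (w + a)) w) => [lew|gtw].
  have /negP[] := @no_carry_pred p k.+1 (p ^ k.+1 - 1 - (w + a)) (w + a) pp ltac:(lia).
  by apply: (bad _ _ (w - (p ^ k.+1 - 1 - (w + a))) 0); lia.
case: (leqP (p ^ k) w) => [leqw|ltwq].
  apply: (negP (@no_carry_multiple p k (w - w %% p ^ k) (w + a) pp _ _)).
  - by rewrite {1}(divn_eq w (p ^ k)) addnK dvdn_mull.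
  - lia.
  - apply: (bad _ _ (w %% p ^ k) 0); rewrite ?subn0 // addn0.
    have := ltn_pmod w q0; have := divn_eq w (p ^ k).
    have : 0 < w %/ p ^ k by rewrite divn_gt0.
    set u := w %/ _; set v := w %% _; set q := p ^ k in q0 *; nia.
apply: (negP (@no_carry_multiple p k w (p ^ k) pp _ _)).
- by rewrite dvdnn orbT.
- lia.
- apply: (bad _ _ 0 (w + a - p ^ k)); lia.
Qed.

(** * Logarithmic estimates *)

Local Open Scope ring_scope.

Lemma ln_nat_gt0 (R : realType) m : (1 < m)%N -> 0 < ln (m%:R : R).
Proof. by move=> m1; rewrite ln_gt0 // ltr1n. Qed.

Lemma alpha_trunc_log (R : realType) p m : (1 < p)%N -> (0 < m)%N ->
  alpha R p m = (trunc_log p m).+1 :> int.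
Proof.
move=> p1 m0; rewrite /alpha /logb.
have lp : 0 < ln (p%:R : R) by apply: ln_nat_gt0.
have /andP[lo hi] := trunc_log_bounds p1 m0.
have lnp k : ln (p%:R : R) *+ k = ln ((p ^ k)%N%:R).
  by rewrite natrX lnXn // ltr0n ltnW.
rewrite intS addrC; congr (_ + _); apply: floor_def.
rewrite addrC -intS -!pmulrn ler_pdivlMr // ltr_pdivrMr // !mulr_natl !lnp.
have p0 k : 0 < (p ^ k)%N%:R :> R by rewrite ltr0n expn_gt0 ltnW.
by rewrite ler_ln ?ltr_ln ?posrE ?p0 ?ltr0n // ler_nat ltr_nat lo hi.
Qed.

Lemma ln_prod (R : realType) (r : nat) (p : 'I_r -> nat) : (forall i, 0 < p i)%N ->
  ln ((\prod_(i < r) p i)%N%:R : R) = \sum_(i < r) ln (p i)%:R.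
Proof.
move=> p0; rewrite natr_prod.
suff [] : 0 < \prod_(i < r) (p i)%:R :> R /\
   ln (\prod_(i < r) (p i)%:R : R) = \sum_(i < r) ln (p i)%:R by [].
elim/big_rec2: _ => [|i y z _ [z0 IH]]; first by rewrite ln1.
by rewrite mulr_gt0 ?ltr0n // lnM ?posrE ?ltr0n // IH.
Qed.

Lemma ln3_ge1 (R : realType) : 1 <= ln (3%:R : R).
Proof.
(* the exponent 6 is large enough: (5 / 6) ^ 6 > 1 / 3 *)
have : (1 - 6^-1) ^+ 6 <= expR (-1) :> R.
  have -> : -1 = 6%:R * (- 6^-1) :> R by field.
  rewrite expRM_natl lerXn2r ?nnegrE ?expR_ge0 ?expR_ge1Dx //; lra.
move=> h; have e3 : expR 1 <= 3 :> R.
  have := @expRxMexpNx_1 R 1; have := expR_gt0 (1 : R); move: h.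
  set u := expR (-1); set v := expR 1; rewrite !exprS expr0 => h v0 uv; nra.
rewrite -ler_expR lnK ?posrE ?ltr0n //.
Qed.

(** Put T = 1 + log_m w, and note that L >= 1 as m >= 3.  Since ln Phi exceeds
    T L = ln (w m) by at most 1 / m, so does S L, and S - T <= 1 / m.  In the
    other direction, T L - S L is at most S (x + 1) / m, where S <= 3 since
    Phi <= m ^ 3; so T - S is at most 3 (x + 1) / m.  That this is below
    4 / sqrt m amounts to 9 (x + 1) ^ 2 < 16 m, which follows from
    3 (x + 1) ^ 2 <= 4 (x ^ 2 + x + 1). *)
Lemma inv_sum_estimate (R : realType) (x w m Phi : nat) (S : R) (L := ln (m%:R : R)) :
  (0 < x)%N -> (x * x + x + 1 <= m)%N -> (1 <= w <= m)%N -> Phi = (1 + w * m)%N ->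
  S * L <= ln Phi%:R -> ln Phi%:R <= S * (L + (x%:R + 1) / m%:R) ->
  `| S - (1 + logb m%:R w%:R) | < 4 / Num.sqrt m%:R.
Proof.
move=> x0 xm /andP[w1 wm] PhiE lo hi; rewrite /logb -/L.
have m3 : (3 <= m)%N by clear -x0 xm; nia.
have sqx : (3 * (x * x + 2 * x + 1) <= 4 * m)%N.
  by clear -x0 xm; case: x x0 xm => // y _; nia.
have cube : (Phi <= m ^ 3)%N.
  by clear -PhiE wm m3; rewrite PhiE !expnS expn0; nia.
have wm_gt0 : (0 < w * m)%N by rewrite muln_gt0 w1; clear -m3; lia.
have m0 : (0 < m%:R :> R) by rewrite ltr0n (leq_trans _ m3).
have w0 : (0 < w%:R :> R) by rewrite ltr0n.
have Phi0 : (0 < Phi%:R :> R) by rewrite ltr0n PhiE.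
have L1 : 1 <= L.
  apply: le_trans (ln3_ge1 R) _; rewrite /L ler_ln ?posrE ?ltr0n //.
    by rewrite ler_nat.
  exact: leq_trans m3.
have L0 : 0 < L by lra.
have TE : (1 + ln w%:R / L) * L = ln (w * m)%N%:R.
  by rewrite natrM lnM ?posrE // mulrDl mul1r divfK ?gt_eqF // addrC.
set T := 1 + _ in TE *.
have lnPhi_lo : ln (w * m)%N%:R <= ln (Phi%:R : R).
  by rewrite ler_ln ?posrE ?ltr0n ?PhiE // ler_nat leq_addl.
have lnPhi_hi : ln (Phi%:R : R) <= ln (w * m)%N%:R + m%:R^-1.
  have wm0 : (0 < (w * m)%N%:R :> R) by rewrite ltr0n.
  have -> : Phi%:R = (w * m)%N%:R * (1 + (w * m)%N%:R^-1) :> R.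
    by rewrite mulrDr mulr1 divff ?gt_eqF // PhiE natrD addrC.
  rewrite lnM ?posrE ?addr_gt0 ?invr_gt0 // lerD2l.
  apply: le_trans (le_ln1Dx _) _; last first.
    by rewrite lef_pV2 ?posrE // ler_nat leq_pmull.
  by apply: lt_trans (_ : 0 < _); rewrite ?invr_gt0 //; lra.
have lnPhi3 : ln (Phi%:R : R) <= 3 * L.
  rewrite -[3]/(3%:R) mulr_natl -lnXn // -natrX ler_ln ?posrE //; first by rewrite ler_nat.
  by rewrite natrX exprn_gt0.
pose q : R := Num.sqrt m%:R; rewrite -/q.
have q0 : 0 < q by rewrite sqrtr_gt0.
have qq : q * q = m%:R by rewrite -expr2 sqr_sqrtr // ltW.
have S3 : S <= 3 by rewrite -(ler_pM2r L0); lra.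
have xq : 3 * (x%:R + 1) < 4 * q :> R.
  move: sqx; rewrite -(ler_nat R) !(natrM, natrD) => h.
  rewrite ltNge; apply/negP => le.
  have x0' : 0 <= x%:R :> R by rewrite ler0n.
  have : (4 * q) * (4 * q) <= (3 * (x%:R + 1)) * (3 * (x%:R + 1)) by apply: ler_pM => //; lra.
  rewrite mulrACA qq => le2.
  suff : 0 < 0 :> R by rewrite ltxx.
  lra.
have q2 : 1 < q.
  have : (1 < m%:R :> R) by rewrite ltr1n (leq_trans _ m3).
  rewrite -qq; nra.
have mL : 0 < m%:R^-1 :> R by rewrite invr_gt0.
have -> : 4 / q = 4 * q / m%:R by rewrite -qq; field; rewrite gt_eqF.
have D1 : S - T <= m%:R^-1.
  by rewrite -(ler_pM2r L0) (@le_trans _ _ m%:R^-1) ?ler_peMr ?(ltW mL) //; lra.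
have D2 : T - S <= 3 * ((x%:R + 1) / m%:R).
  set e := (x%:R + 1) / m%:R in hi *.
  have e0 : 0 <= e by rewrite divr_ge0 ?addr_ge0 ?ler0n.
  have : (T - S) * L <= 3 * e by have := ler_wpM2r e0 S3; lra.
  move=> h; rewrite -(ler_pM2r L0); apply: le_trans h _.
  by rewrite ler_peMr // mulr_ge0.
have D3 : 3 * ((x%:R + 1) / m%:R) < 4 * q / m%:R.
  by rewrite mulrA ltr_pM2r //.
have D4 : m%:R^-1 < 4 * q / m%:R.
  by rewrite ltr_pMl //; lra.
rewrite ltr_norml; apply/andP; split; lra.
Qed.

(** These are the bounds L <= ln (p ^ alpha) <= ln (m + x + 1), divided by
    alpha. *)
Lemma inv_alpha_bounds (R : realType) (p m x : nat) (L := ln (m%:R : R))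
    (b := ((alpha R p m)%:~R : R)^-1) : (1 < p)%N -> (0 < m)%N ->
  (p ^ (trunc_log p m).+1 <= m + x + 1)%N ->
  b * L <= ln p%:R /\ ln (p%:R : R) <= b * (L + (x%:R + 1) / m%:R).
Proof.
move=> p1 m0 close.
have mR : 0 < m%:R :> R by rewrite ltr0n.
have pk0 k : 0 < (p ^ k)%N%:R :> R by rewrite ltr0n expn_gt0 ltnW.
have [_ hi] := andP (trunc_log_bounds p1 m0).
rewrite /b alpha_trunc_log // -pmulrn.
move: (trunc_log p m).+1 (ltn0Sn (trunc_log p m)) close hi => k k0 close hi.
have kR : 0 < k%:R :> R by rewrite ltr0n.
have lnp : k%:R * ln (p%:R : R) = ln (p ^ k)%N%:R.
  by rewrite mulr_natl natrX lnXn // ltr0n ltnW.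
rewrite !(mulrC _^-1) ler_pdivrMr // ler_pdivlMr // ![ln p%:R * _]mulrC lnp; split.
  by rewrite ler_ln ?posrE // ler_nat ltnW.
have q0 : 0 <= (x%:R + 1) / m%:R :> R by rewrite divr_ge0 ?addr_ge0 ?ler0n.
have q1 : 0 < 1 + (x%:R + 1) / m%:R :> R by lra.
have step : ln (1 + (x%:R + 1) / m%:R) <= (x%:R + 1) / m%:R :> R.
  by apply: le_ln1Dx; lra.
apply: le_trans (_ : ln (m%:R * (1 + (x%:R + 1) / m%:R)) <= _).
  rewrite ler_ln ?posrE ?mulr_gt0 // mulrDr mulr1 mulrCA divff ?gt_eqF // mulr1 addrA.
  by rewrite -!natrD -[1]/(1%:R) -natrD ler_nat.
by rewrite lnM ?posrE // lerD2l.
Qed.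

Theorem theorem6 (R : realType) (w a n : nat) (hw : (1 <= w)%N)
  (hn : n = (2 * w + a)%N)
  (hC : exists C : {set {set 'I_n}}, perfect1 w C /\ ~ trivial_code w C)
  (r : nat) (p : 'I_r -> nat) (hp : forall i : 'I_r, prime (p i))
  (hprod : Phi1 w a = (\prod_(i < r) p i)%N) :
  `| \sum_(i < r) ((alpha R (p i) (w + a))%:~R)^-1
     - (1 + logb (w + a)%:R w%:R) | < 4 / Num.sqrt (w + a)%:R :> R.
Proof.
have [C [pC ntC]] := hC.
have [x [x0 wE dvC]] := nontrivial_parameters hw hn pC ntC.
have dvP i j : (i + j < w - x)%N -> (Phi1 w a %| 'C(2 * w + a - i - j, w - i))%N.
  move=> ij; apply: (dvd_bin_Pascal (t := (w - x).-1)); try lia.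
  by move=> i' i'x; rewrite -hn; apply: dvC; lia.
have close i : ((p i) ^ (trunc_log (p i) (w + a)).+1 <= w + a + x + 1)%N.
  apply: (prime_power_close x0 wE (hp i)).
    move=> i' j ij; apply: dvdn_trans (dvP i' j ij).
    by rewrite hprod (bigD1 i) //= dvdn_mulr.
  by apply: trunc_log_bounds; [exact: prime_gt1 | lia].
have bounds i := inv_alpha_bounds R (prime_gt1 (hp i)) (ltn_addr a hw) (close i).
apply: (inv_sum_estimate x0 (Phi := Phi1 w a) (w := w)) => //; try (by nia).
- rewrite hprod ln_prod => [|i]; last exact: prime_gt0.
  by rewrite mulr_suml; apply: ler_sum => i _; have [] := bounds i.
- rewrite hprod ln_prod => [|i]; last exact: prime_gt0.
  by rewrite mulr_suml; apply: ler_sum => i _; have [] := bounds i.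
Qed.
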